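(* Let $K=\{1,2,3\}$, $A=\{a,b,c\}$, $X=\Delta(A)$, $u_0^k=0$ for $k=1,2,3$, and let $U^k,V^k:X\to\mathbb{R}$ be the affine (expected utility) functions $U^k(x)=\sum_{\alpha\in A}x_\alpha U^k(\alpha)$, $V^k(x)=\sum_{\alpha\in A}x_\alpha V^k(\alpha)$, where the values $(U^k(\alpha),V^k(\alpha))$ are $$\begin{array}{c|ccc} & a & b & c\\ \hline k=1 & (0,2) & (-2,0) & (1,1)\\ k=2 & (1,1) & (0,2) & (-2,0)\\ k=3 & (-2,0) & (1,1) & (0,2)\end{array}$$ Let $p\in\Delta(K)$ be any prior with $p^k>0$ for every $k\in K$. Then the sender-receiver game $\Gamma$ with these data has no equilibrium $(\sigma,\tau)$, even if player 1 is allowed to use a mixed strategy $\sigma:K\to\Delta(M)$. However, $\Gamma$ has a mediated equilibrium.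
   Context: The game $\Gamma$. $K$ is a finite set of types with prior $p\in\Delta(K)$; $M$ is a finite set of messages with $|M|\ge|K|$; $X$ is the compact set of decisions; $U^k,V^k:X\to\mathbb{R}$ are the utilities of the sender (player 1) and receiver (player 2) when the type is $k$; $u_0^k$ is the sender's outside option. ($\Delta(S)$ denotes the set of probability distributions on a finite set $S$.) A type $k$ is drawn from $p$ and told to the sender, who sends a message $m\in M$; the receiver then proposes $x\in X$; if the sender accepts, payoffs are $U^k(x),V^k(x)$; if he rejects (exit), he gets $u_0^k$ and the receiver gets $-\infty$. The sender of type $k$ accepts $x$ if and only if $U^k(x)\ge u_0^k$. The receiver's equilibrium expected utility is required to be finite. For $L\subseteq K$ let $X(L)=\{x\in X: U^k(x)\ge u_0^k \ \forall k\in L\}$. A strategy of the sender is a map $\sigma:K\to\Delta(M)$, written $\sigma(m\mid k)$; a strategy of the receiver is a map $\tau:M\to X$. Put $P_\sigma(m)=\sum_{k}p^k\sigma(m\mid k)$ and, if $P_\sigma(m)>0$, $p_m^k(\sigma)=p^k\sigma(m\mid k)/P_\sigma(m)$, $p_m(\sigma)=(p_m^k(\sigma))_{k\in K}$. An equilibrium of $\Gamma$ is a pair $(\sigma,\tau)$ such that (1) $U^k(\tau(m))\ge U^k(\tau(m'))$ for all $k\in K$, all $m\in M$ with $\sigma(m\mid k)>0$ and all $m'\in M$; (2) for every $m\in M$ with $P_\sigma(m)>0$, $X(\mathrm{supp}\,p_m(\sigma))\ne\emptyset$ and $\tau(m)\in\arg\max_{x\in X(\mathrm{supp}\,p_m(\sigma))}\sum_{k}p_m^k(\sigma)V^k(x)$.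 Mediated equilibrium. Instead of sending a message directly to the receiver, the sender reports a type in $K$ to a mediator, who then selects a decision in $X$ and recommends it to the receiver. A mediator is a map $\mu$ assigning to every $k\in K$ a finitely supported probability distribution $\mu(\cdot\mid k)$ on $X$. For $x$ with $P_\mu(x)=\sum_k p^k\mu(x\mid k)>0$, let $p_x^k=p^k\mu(x\mid k)/P_\mu(x)$ and $p_x=(p_x^k)_{k\in K}$. A mediated equilibrium is a mediator $\mu$ such that: (1) for all $k,j\in K$, $\sum_x\mu(x\mid k)U^k(x)\ge\sum_x\mu(x\mid j)\max\{U^k(x),u_0^k\}$; (2) for every $x$ with $P_\mu(x)>0$, $x\in X(\mathrm{supp}\,p_x)$ and $x$ maximizes $\sum_k p_x^kV^k(y)$ over $y\in X(\mathrm{supp}\,p_x)$. *)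

(* Defs.v *)
From HB Require Import structures.
From mathcomp Require Import all_boot all_order all_algebra.
From mathcomp Require Import boolp classical_sets cardinality fsbigop reals.

Set Implicit Arguments.
Unset Strict Implicit.
Unset Printing Implicit Defensive.

Import Order.TTheory GRing.Theory Num.Theory.

Local Open Scope classical_set_scope.
Local Open Scope ring_scope.

(* The set Delta(S) of probability distributions on a finite set S. *)
Record fdist (R : realType) (S : finType) := FDist {
  fdist_ffun :> {ffun S -> R};
  fdistP : [forall s, 0 <= fdist_ffun s] && (\sum_s fdist_ffun s == 1) }.

HB.instance Definition _ (R : realType) (S : finType) :=
  [isSub for @fdist_ffun R S].
HB.instance Definition _ (R : realType) (S : finType) :=
  [Choice of fdist R S by <:].

(* Finitely supported probability distributions on an arbitrary X. Finiteness
   of the support is what makes the sums over [set: X] meaningful: fsbigop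
   returns 0 on a family with infinite support. *)
Record fsdist (R : realType) (X : choiceType) := FSDist {
  fsdist_fun :> X -> R;
  fsdist_ge0 : forall x, 0 <= fsdist_fun x;
  fsdist_finite : finite_set [set x | fsdist_fun x != 0];
  fsdist_sum1 : \sum_(x \in [set: X]) fsdist_fun x = 1 }.

Definition argmax (R : realType) (X : Type) (D : set X) (f : X -> R) : set X :=
  [set x | D x /\ forall y, D y -> f y <= f x].

(* Bayes' rule for a prior p and a likelihood l: here l k is the probability,
   given type k, of the message sent or of the decision recommended. When
   marginal p l = 0, posterior p l is identically 0 and is never used. *)
Definition marginal (R : realType) (K : finType) (p : fdist R K)
  (l : K -> R) : R := \sum_k p k * l k.

Definition posterior (R : realType) (K : finType) (p : fdist R K)
  (l : K -> R) (k : K) : R := p k * l k / marginal p l.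

Definition supp (R : realType) (K : finType) (q : K -> R) : {set K} :=
  [set k | 0 < q k]%SET.

(* The message set is not a field: it is carried by the sender's strategy. *)
Record game (R : realType) (K : finType) (X : choiceType) := Game {
  prior : fdist R K;
  sender_utility : K -> X -> R;
  receiver_utility : K -> X -> R;
  outside_option : K -> R }.

(* X(L): the decisions from which no type in L exits. *)
Definition acceptable (R : realType) (K : finType) (X : choiceType)
  (G : game R K X) (L : {set K}) : set X :=
  [set x | forall k, k \in L -> outside_option G k <= sender_utility G k x].

Definition expected_receiver_utility (R : realType) (K : finType)
  (X : choiceType) (G : game R K X) (q : K -> R) (x : X) : R :=
  \sum_k q k * receiver_utility G k x.

(* Exit costs the receiver -oo, so a reply giving finite utility at belief q
   must be accepted by every type in the support of q. *)
Definition receiver_optima (R : realType) (K : finType) (X : choiceType)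
  (G : game R K X) (q : K -> R) : set X :=
  argmax (acceptable G (supp q)) (expected_receiver_utility G q).

(* sigma k m is the probability that type k sends message m. *)
Definition equilibrium (R : realType) (K M : finType) (X : choiceType)
  (G : game R K X) (sigma : K -> fdist R M) (tau : M -> X) : Prop :=
  (forall k m m', 0 < sigma k m ->
     sender_utility G k (tau m') <= sender_utility G k (tau m)) /\
  (forall m, 0 < marginal (prior G) (fun k => sigma k m) ->
     let q := posterior (prior G) (fun k => sigma k m) in
     acceptable G (supp q) !=set0 /\ receiver_optima G q (tau m)).

(* mu k x is the probability that decision x is recommended when type k is
   reported. *)
Definition mediated_equilibrium (R : realType) (K : finType) (X : choiceType)
  (G : game R K X) (mu : K -> fsdist R X) : Prop :=
  (forall k j,
     \sum_(x \in [set: X])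
        mu j x * Num.max (sender_utility G k x) (outside_option G k)
     <= \sum_(x \in [set: X]) mu k x * sender_utility G k x) /\
  (forall x, 0 < marginal (prior G) (fun k => mu k x) ->
     receiver_optima G (posterior (prior G) (fun k => mu k x)) x).

Definition expectation (R : realType) (A : finType) (f : A -> R)
  (x : fdist R A) : R := \sum_a x a * f a.

(* Types 1, 2, 3 and actions a, b, c are the ordinals 0, 1, 2. *)
Definition payoff_table (R : realType) : seq (seq (R * R)) :=
  [:: [:: (0, 2);  (-2, 0); (1, 1)];
      [:: (1, 1);  (0, 2);  (-2, 0)];
      [:: (-2, 0); (1, 1);  (0, 2)]].

Definition payoff (R : realType) (k a : 'I_3) : R * R :=
  nth (0, 0) (nth [::] (payoff_table R) k) a.

Definition three_type_game (R : realType) (p : fdist R 'I_3) :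
  game R 'I_3 (fdist R 'I_3) :=
  {| prior := p;
     sender_utility := fun k => expectation (fun a => (payoff R k a).1);
     receiver_utility := fun k => expectation (fun a => (payoff R k a).2);
     outside_option := fun=> 0 |}.

(* Main.v *)
Require Import Defs.
From mathcomp Require Import all_boot all_order all_algebra.
From mathcomp Require Import boolp classical_sets cardinality fsbigop.
From mathcomp Require Import reals.
From mathcomp Require Import lra.

Import Order.TTheory GRing.Theory Num.Theory.
Local Open Scope ring_scope.

(** Types and actions are both indexed by the integers modulo 3, and the table
    is invariant under shifting type and action together: the pair of payoffs
    of type k is (0, 2) at action k, (-2, 0) at action k + 1 and (1, 1) at
    action k - 1 ([payoffE]).

    The whole game reduces to pure decisions.  No decision satisfies all three
    participation constraints, because adding them gives 1 >= 2.  Hence the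
    support of the belief that follows a message on the equilibrium path is
    {k} or {k, k + 1} for some k, and at such a belief the receiver has a unique
    best reply, the pure action k ([receiver_optima_pure]).

    For the impossibility, take any message in use.  The reply is the pure
    action k of some type k that sends it, and this gives type k payoff 0.  So
    the action k - 1, which type k likes better, is not proposed after any
    message.  Type k - 1 must then send a message answered by the action i of
    some type i, where the support is {i} or {i, i + 1} and i is not k - 1:
    thus i = k + 1, and type k + 1 sends that message and gets 0, while the
    first message would give it 1.

    For the mediated equilibrium, let type k receive the actions k and k - 1
    with probability 1/2 each.  The decision k is then recommended exactly to
    types k and k + 1, so it is the receiver's optimum whatever the prior.  The
    sender gets 1/2 by telling the truth, and at most 1/2 by lying, even with
    the option to exit. *)

Set Implicit Arguments.
Unset Strict Implicit.
Unset Printing Implicit Defensive.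

(** * Distributions *)

Section Distributions.
Variable R : realType.

Lemma fdist_ge0 (S : finType) (x : fdist R S) s : 0 <= x s.
Proof. by have /andP[/forallP/(_ s)] := fdistP x. Qed.

Lemma fdist_sum1 (S : finType) (x : fdist R S) : \sum_s x s = 1.
Proof. by have /andP[_ /eqP] := fdistP x. Qed.

Lemma fdist_inj (S : finType) (x y : fdist R S) : (forall s, x s = y s) -> x = y.
Proof. by move=> xy; apply/val_inj/ffunP. Qed.

Lemma fdist_support (S : finType) (x : fdist R S) : exists s, 0 < x s.
Proof.
apply: contrapT => /forallNP x0; have := fdist_sum1 x.
rewrite big1 => [/esym/eqP|s _]; first by rewrite oner_eq0.
by apply/eqP; rewrite eq_le fdist_ge0 andbT leNgt; apply/negP/x0.
Qed.

Lemma pure_subproof (S : finType) (a : S) (f := [ffun s => (s == a)%:R : R]) :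
  [forall s, 0 <= f s] && (\sum_s f s == 1).
Proof.
apply/andP; split; first by apply/forallP => s; rewrite ffunE ler0n.
rewrite (bigD1 a)//= big1 => [|s /negbTE sa]; rewrite ffunE ?sa//.
by rewrite eqxx addr0.
Qed.

Definition pure (S : finType) (a : S) : fdist R S := FDist (pure_subproof a).

Lemma pureE (S : finType) (a s : S) : pure a s = (s == a)%:R.
Proof. exact: ffunE. Qed.

Lemma pure_inj (S : finType) : injective (@pure S).
Proof.
move=> a b ab; apply/eqP; have := pureE b a.
by rewrite -ab pureE eqxx; case: eqP => // _ /eqP; rewrite oner_eq0.
Qed.

Lemma expectation_pure (S : finType) (f : S -> R) a :
  expectation f (pure a) = f a.
Proof.
rewrite /expectation (bigD1 a)//= big1 => [|s /negbTE sa]; rewrite pureE ?sa//.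
  by rewrite eqxx mul1r addr0.
by rewrite mul0r.
Qed.

Section Pushforward.
Variables (A : finType) (X : choiceType) (w : fdist R A) (e : A -> X).

Let mass x := \sum_(a | e a == x) w a.

Lemma fsbig_mass (f : X -> R) :
  \sum_(x \in [set: X]) mass x * f x = \sum_a w a * f (e a).
Proof.
have mass0 x : x \notin undup (codom e) -> mass x = 0.
  rewrite mem_undup => xe; rewrite /mass big_pred0// => a.
  by apply/negP => /eqP ax; rewrite -ax codom_f in xe.
rewrite (fsbigE (undup (codom e))) ?undup_uniq//; last first.
  by move=> x _ /mass0 ->; rewrite mul0r.
under eq_bigl do rewrite in_setT.
under eq_bigr do rewrite big_distrl/=.
rewrite (exchange_big_dep predT)//=; apply: eq_bigr => a _.
rewrite -big_filter.
rewrite (_ : [seq x <- _ | _] = [:: e a]) ?big_seq1//.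
rewrite -(@filter_pred1_uniq _ (undup (codom e)) (e a)) ?undup_uniq//.
  by apply: eq_filter => x /=; rewrite eq_sym.
by rewrite mem_undup codom_f.
Qed.

Lemma mass_ge0 x : 0 <= mass x.
Proof. by apply: sumr_ge0 => a _; exact: fdist_ge0. Qed.

Lemma mass_finite : finite_set [set x | mass x != 0].
Proof.
apply: (@sub_finite_set _ _ (e @` [set: A])%classic); last first.
  exact/finite_image/finite_finset.
move=> x /= mx; apply: contrapT => ex; move/negP: mx; apply; apply/eqP.
by rewrite /mass big_pred0// => a; apply/negP => /eqP ax; apply: ex; exists a.
Qed.

Lemma mass_sum1 : \sum_(x \in [set: X]) mass x = 1.
Proof.
have := fsbig_mass (fun=> 1).
under eq_fsbigr do rewrite mulr1.
by move->; under eq_bigr do rewrite mulr1; exact: fdist_sum1.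
Qed.

(** The law of [e] under [w], which is finitely supported since [w] lives on a
    finite set. *)
Definition pushforward : fsdist R X := FSDist mass_ge0 mass_finite mass_sum1.

Lemma fsbig_pushforward (f : X -> R) :
  \sum_(x \in [set: X]) pushforward x * f x = \sum_a w a * f (e a).
Proof. exact: fsbig_mass. Qed.

Lemma pushforward_gt0P x :
  0 < pushforward x <-> exists2 a, e a = x & 0 < w a.
Proof.
split=> [mx|[a ax wa]].
  apply: contrapT => no; move: mx; rewrite /= /mass big1 ?ltxx// => a /eqP ax.
  apply/eqP; rewrite eq_le fdist_ge0 andbT leNgt.
  by apply/negP => wa; apply: no; exists a.
rewrite /= /mass (bigD1 a) ?ax//= ltr_wpDr// sumr_ge0// => b _.
exact: fdist_ge0.
Qed.

End Pushforward.

Section Bayes.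
Variables (K : finType) (p : fdist R K) (l : K -> R).
Hypothesis p_gt0 : forall k, 0 < p k.
Hypothesis l_ge0 : forall k, 0 <= l k.

Lemma marginal_ge0 : 0 <= marginal p l.
Proof. by apply: sumr_ge0 => k _; rewrite mulr_ge0// ltW. Qed.

Lemma marginal_gt0 k : 0 < l k -> 0 < marginal p l.
Proof.
move=> lk; rewrite /marginal (bigD1 k)//= ltr_wpDr ?mulr_gt0//.
by apply: sumr_ge0 => j _; rewrite mulr_ge0// ltW.
Qed.

Lemma marginal_gt0_exists : 0 < marginal p l -> exists k, 0 < l k.
Proof.
move=> m0; apply: contrapT => /forallNP no; move: m0.
rewrite /marginal big1 ?ltxx// => k _.
suff -> : l k = 0 by rewrite mulr0.
by apply/eqP; rewrite eq_le l_ge0 andbT leNgt; apply/negP/no.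
Qed.

Lemma posterior_ge0 k : 0 <= posterior p l k.
Proof. by rewrite divr_ge0 ?marginal_ge0// mulr_ge0// ltW. Qed.

Lemma posterior_gt0 k :
  0 < marginal p l -> (0 < posterior p l k) = (0 < l k).
Proof. by move=> m0; rewrite /posterior pmulr_lgt0 ?invr_gt0// pmulr_rgt0. Qed.

End Bayes.
End Distributions.

(** * The cyclic structure of the game *)

Section Cyclic.
Variable R : realType.
Implicit Types (k : 'I_3) (x : fdist R 'I_3).

Lemma ord3P k j : [\/ j = k, j = k + 1 | j = k - 1].
Proof.
case: k => [[|[|[|//]]] ?]; case: j => [[|[|[|//]]] ?];
by [constructor 1; apply/val_inj|constructor 2; apply/val_inj
   |constructor 3; apply/val_inj].
Qed.

Lemma subr1K k : k - 1 - 1 = k + 1.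
Proof. by case: k => [[|[|[|//]]] ?]; apply/val_inj. Qed.

Lemma addr11 k : k + 1 + 1 = k - 1.
Proof. by rewrite -subr1K addrK. Qed.

Lemma ord3_shift_neq k :
  [/\ (k == k + 1) = false, (k == k - 1) = false & (k + 1 == k - 1) = false].
Proof. by case: k => [[|[|[|//]]] ?]; split. Qed.

Lemma sum_ord3 k (F : 'I_3 -> R) : \sum_a F a = F k + F (k + 1) + F (k - 1).
Proof.
have [k1 k2 k12] := ord3_shift_neq k.
rewrite (bigD1 k)//= (bigD1 (k + 1))/=; last by rewrite eq_sym k1.
rewrite (bigD1 (k - 1))/=; last by rewrite ![k - 1 == _]eq_sym k2 k12.
rewrite big_pred0 ?addr0 ?addrA// => a.
by have [->|->|->] := ord3P k a; rewrite eqxx ?andbF.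
Qed.

Lemma payoffE k :
  [/\ payoff R k k = (0, 2), payoff R k (k + 1) = (-2, 0)
    & payoff R k (k - 1) = (1, 1)].
Proof. by case: k => [[|[|[|//]]] ?]; split. Qed.

Variable p : fdist R 'I_3.
Notation U := (sender_utility (three_type_game p)).
Notation V := (receiver_utility (three_type_game p)).

Lemma sender_utilityE k x : U k x = x (k - 1) - 2 * x (k + 1).
Proof.
rewrite /= /expectation (sum_ord3 k); have [-> -> ->] /= := payoffE k; lra.
Qed.

Lemma receiver_utilityE k x : V k x = 2 * x k + x (k - 1).
Proof.
rewrite /= /expectation (sum_ord3 k); have [-> -> ->] /= := payoffE k; lra.
Qed.

Lemma sender_utility_pure k :
  [/\ U k (pure R k) = 0, U k (pure R (k + 1)) = -2
    & U k (pure R (k - 1)) = 1].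
Proof. by have [e0 e1 e2] := payoffE k; rewrite /= !expectation_pure e0 e1 e2. Qed.

(** At a belief whose support is {k} or {k, k + 1}, the receiver's loss from x
    instead of the pure action k is
    q_k (2 x_{k+1} + x_{k-1}) + q_{k+1} (x_{k-1} - x_{k+1}).  The participation
    constraint x_{k-1} >= 2 x_{k+1} of type k makes both terms nonnegative, and
    the first one vanishes only at the pure action k. *)
Lemma receiver_optima_pure (q : 'I_3 -> R) k x :
    (forall j, 0 <= q j) -> 0 < q k -> q (k - 1) = 0 ->
  receiver_optima (three_type_game p) q x <-> x = pure R k.
Proof.
move=> q_ge0 qk q0; have qk0 := ltW qk.
have EV y : expected_receiver_utility (three_type_game p) q y =
    q k * (2 * y k + y (k - 1)) + q (k + 1) * (2 * y (k + 1) + y k).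
  rewrite /expected_receiver_utility (sum_ord3 k) q0 mul0r addr0.
  by rewrite !receiver_utilityE addrK.
have mass1 (y : fdist R 'I_3) : y k = 1 - y (k + 1) - y (k - 1).
  by rewrite -(fdist_sum1 y) (sum_ord3 k); lra.
have [k1 k2 k12] := ord3_shift_neq k.
have EVk : expected_receiver_utility (three_type_game p) q (pure R k) =
    2 * q k + q (k + 1).
  by rewrite EV !pureE eqxx ![_ == k]eq_sym k1 k2 /=; lra.
have acc_k y : acceptable (three_type_game p) (supp q) y ->
    2 * y (k + 1) <= y (k - 1).
  by move=> /(_ k); rewrite inE qk sender_utilityE/= => /(_ isT); lra.
have acc_pure : acceptable (three_type_game p) (supp q) (pure R k).
  move=> j; rewrite inE => qj.
  have [jk|jk|jk] := ord3P k j.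
  - by rewrite jk; have [-> _ _] := sender_utility_pure k.
  - rewrite jk; have [_ _] := sender_utility_pure (k + 1).
    by rewrite addrK => ->; exact: ler01.
  - by move: qj; rewrite jk q0 ltxx.
split=> [[/acc_k xk /(_ _ acc_pure)]|->]; last first.
  split=> // y /acc_k yk; rewrite EVk EV mass1.
  have y1 := fdist_ge0 y (k + 1).
  have := mulr_ge0 qk0 y1.
  have := mulr_ge0 (q_ge0 (k + 1)) y1.
  have : 0 <= q (k + 1) * (y (k - 1) - 2 * y (k + 1)).
    by rewrite mulr_ge0 ?subr_ge0.
  have : 0 <= q k * (y (k - 1) - 2 * y (k + 1)).
    by rewrite mulr_ge0 ?subr_ge0.
  lra.
rewrite EVk EV mass1 => opt.
have x1 := fdist_ge0 x (k + 1); have x2 := fdist_ge0 x (k - 1).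
have x20 : x (k - 1) = 0.
  apply/eqP; rewrite eq_le x2 andbT -(pmulr_rle0 _ qk).
  have := mulr_ge0 qk0 x1.
  have := mulr_ge0 (q_ge0 (k + 1)) x1.
  have : 0 <= q (k + 1) * (x (k - 1) - 2 * x (k + 1)).
    by rewrite mulr_ge0 ?subr_ge0.
  lra.
have x10 : x (k + 1) = 0 by lra.
apply: fdist_inj => a; rewrite pureE; have [->|->|->] := ord3P k a.
- by rewrite eqxx mass1 x10 x20 !subr0.
- by rewrite eq_sym k1.
- by rewrite eq_sym k2.
Qed.

(** Adding the participation constraints x_{j-1} >= 2 x_{j+1} over the three
    types gives 1 >= 2.  So some type is missing from the support, and the
    first type of the support after it in the cyclic order is the required k. *)
Lemma acceptable_support_gap (q : 'I_3 -> R) :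
    (forall j, 0 <= q j) -> (exists j, 0 < q j) ->
    (acceptable (three_type_game p) (supp q) !=set0)%classic ->
  exists2 k, 0 < q k & q (k - 1) = 0.
Proof.
move=> q_ge0 [j qj] [x accx]; apply: contrapT => no.
have prev k : 0 < q k -> 0 < q (k - 1).
  move=> qk; rewrite lt_neqAle q_ge0 andbT eq_sym.
  by apply/eqP => q0; apply: no; exists k.
have acc k : 0 < q k -> 2 * x (k + 1) <= x (k - 1).
  by move=> qk; have := accx k; rewrite inE qk sender_utilityE/= => /(_ isT); lra.
have qj1 := prev _ qj; have := prev _ qj1; rewrite subr1K => qj2.
have := fdist_sum1 x; rewrite (sum_ord3 j).
have := acc _ qj; have := acc _ qj1; have := acc _ qj2.
rewrite addrK subrK subr1K addr11; lra.
Qed.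

(** * No equilibrium *)

Lemma no_equilibrium (M : finType) (sigma : 'I_3 -> fdist R M)
    (tau : M -> fdist R 'I_3) :
  (forall k, 0 < p k) -> ~ equilibrium (three_type_game p) sigma tau.
Proof.
move=> p_gt0 [IC BR].
have reply j m : 0 < sigma j m ->
    exists k, [/\ 0 < sigma k m, ~ 0 < sigma (k - 1) m & tau m = pure R k].
  move=> sjm; have s_ge0 i : 0 <= sigma i m := fdist_ge0 _ _.
  have m0 : 0 < marginal p (fun i => sigma i m) := marginal_gt0 p_gt0 s_ge0 sjm.
  have q_ge0 := posterior_ge0 p_gt0 s_ge0.
  have q_gt0 i := posterior_gt0 p_gt0 i m0.
  have [acc opt] := BR m m0.
  have qj : exists i, 0 < posterior p (fun i => sigma i m) i.
    by exists j; rewrite q_gt0.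
  have [k qk q0] := acceptable_support_gap q_ge0 qj acc.
  exists k; split; first by rewrite -q_gt0.
    by rewrite -q_gt0 q0 ltxx.
  exact/(receiver_optima_pure _ q_ge0 qk q0).
have [m0 /reply[k [skm _ tau_m0]]] := fdist_support (sigma 0).
have unused m : tau m <> pure R (k - 1).
  move=> tau_m; have := IC _ _ m skm; rewrite tau_m tau_m0.
  by have [-> _ ->] := sender_utility_pure k; rewrite ler10.
have [m skm1] := fdist_support (sigma (k - 1)).
have [i [sim ni tau_m]] := reply _ _ skm1.
have [ik|ik|ik] := ord3P k i.
- by apply: ni; rewrite ik.
- have := IC _ _ m0 sim; rewrite tau_m tau_m0.
  have [-> _] := sender_utility_pure i; rewrite {2}ik addrK => ->.
  by rewrite ler10.
- by apply: (unused m); rewrite tau_m ik.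
Qed.

(** * The mediated equilibrium *)

Lemma fair_coin_subproof (f := [ffun=> 2^-1] : {ffun bool -> R}) :
  [forall s, 0 <= f s] && (\sum_s f s == 1).
Proof.
apply/andP; split; first by apply/forallP => s; rewrite ffunE invr_ge0.
by rewrite big_bool !ffunE /= [eqbRHS]splitr div1r.
Qed.

Definition fair_coin : fdist R bool := FDist fair_coin_subproof.

Definition fair_mediator k : fsdist R (fdist R 'I_3) :=
  pushforward fair_coin (fun b => pure R (if b then k else k - 1)).

Lemma fsbig_fair_mediator k (f : fdist R 'I_3 -> R) :
  \sum_(x \in [set: fdist R 'I_3]) fair_mediator k x * f x =
  (f (pure R k) + f (pure R (k - 1))) / 2.
Proof. by rewrite fsbig_pushforward big_bool !ffunE /= -mulrDr mulrC. Qed.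

Lemma fair_mediator_gt0 k a :
  0 < fair_mediator k (pure R a) <-> a = k \/ a = k - 1.
Proof.
rewrite /fair_mediator pushforward_gt0P.
split=> [[[] /pure_inj <-]|]; [by left|by right|].
by case=> ->; [exists true|exists false]; rewrite // ffunE invr_gt0.
Qed.

Lemma fair_mediator_equilibrium :
  (forall k, 0 < p k) -> mediated_equilibrium (three_type_game p) fair_mediator.
Proof.
move=> p_gt0; split=> [k j|x].
  rewrite !fsbig_fair_mediator ler_pM2r ?invr_gt0//.
  have [U0 U1 U2] := sender_utility_pure k.
  rewrite U0 U2 add0r.
  (* A report j = k + 1 leads to actions k + 1 and k, worth -2 and 0, and a
     report j = k - 1 to actions k - 1 and k + 1, worth 1 and -2. *)
  have [->|->|->] := ord3P k j; rewrite ?addrK ?subr1K ?U0 ?U1 ?U2 /=;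
    by rewrite /Num.max; do !case: ifP => _; lra.
have mu_ge0 i : 0 <= fair_mediator i x := fsdist_ge0 (fair_mediator i) x.
move=> m0; have [k muk] := marginal_gt0_exists mu_ge0 m0.
have [b xE _] := (pushforward_gt0P _ _ _).1 muk.
set a := if b then k else k - 1 in xE; rewrite -{x}xE in mu_ge0 m0 muk *.
have q_ge0 := posterior_ge0 p_gt0 mu_ge0.
have q_gt0 i := posterior_gt0 p_gt0 i m0.
apply/(receiver_optima_pure _ q_ge0 (k := a)) => //.
  by rewrite q_gt0; apply/fair_mediator_gt0; left.
apply/eqP; rewrite eq_le q_ge0 andbT leNgt q_gt0.
apply/negP => /fair_mediator_gt0; have [a1 a2 _] := ord3_shift_neq a.
by rewrite subr1K; case=> /eqP; rewrite ?a1 ?a2.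
Qed.

End Cyclic.

Theorem mainTheorem7 (R : realType) (p : fdist R 'I_3)
  (hp : forall k : 'I_3, 0 < p k) (M : finType) (hM : (#|'I_3| <= #|M|)%N) :
  (~ exists (sigma : 'I_3 -> fdist R M) (tau : M -> fdist R 'I_3),
       equilibrium (three_type_game p) sigma tau) /\
  (exists mu : 'I_3 -> fsdist R (fdist R 'I_3),
     mediated_equilibrium (three_type_game p) mu).
Proof.
split=> [[sigma [tau]]|]; first exact: no_equilibrium.
by exists (@fair_mediator R); exact: fair_mediator_equilibrium.
Qed.
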